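(* Let $\kappa$ be an uncountable cardinal such that $\kappa$ and $\mathrm{cf}(\kappa)$ are not both strong limit cardinals. Then there exist a real Banach space $X$ and a bounded subset $A\subset X$ with $|A|=\kappa$ such that: (i) $A$ contains no weakly Cauchy sequence, i.e. no sequence of pairwise distinct elements of $A$ is weakly Cauchy in $X$; (ii) no subset of $A$ is equivalent to the usual $\ell_1(\kappa)$-basis.
   Context: A cardinal $\mu$ is a strong limit cardinal if $2^\lambda<\mu$ for every cardinal $\lambda<\mu$ (so $\aleph_0$ is a strong limit cardinal). $\mathrm{cf}(\kappa)$ is the cofinality of $\kappa$. A sequence $(x_n)$ in a Banach space $X$ is weakly Cauchy if the scalar sequence $(f(x_n))$ converges for every $f\in X^\ast$. A subset $D$ of a Banach space with cardinality $\kappa$ is equivalent to the usual $\ell_1(\kappa)$-basis if there are constants $C_1,C_2>0$ such that $C_1\sum_{i=1}^n|a_i|\le\|\sum_{i=1}^n a_ix_i\|\le C_2\sum_{i=1}^n|a_i|$ for every $n\in\mathbb{N}$, all pairwise distinct $x_1,\dots,x_n\in D$ and all scalars $a_1,\dots,a_n$. *)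

(* Defs.v *)
From HB Require Import structures.
From mathcomp Require Import all_boot all_order all_algebra.
From mathcomp Require Import all_classical all_reals all_analysis.
From mathcomp Require wochoice.

Set Implicit Arguments.
Unset Strict Implicit.
Unset Printing Implicit Defensive.

Import Order.TTheory GRing.Theory Num.Theory.
Import numFieldNormedType.Exports.

Local Open Scope classical_set_scope.
Local Open Scope card_scope.
Local Open Scope ring_scope.

(* A cardinal is represented by any type [K] of that cardinality; equality and
   order of cardinals are [#=] and [#<=] between the full sets [[set: K]]. *)

Definition card_lt (T U : Type) (A : set T) (B : set U) : Prop :=
  A #<= B /\ ~ (A #= B).

Definition strong_limit (M : Type) : Prop :=
  forall L : Type,
    card_lt [set: L] [set: M] -> card_lt [set: set L] [set: M].

(* [r], read as [<=], makes [K] isomorphic to the initial ordinal of the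
   cardinal of [K]: proper initial segments have strictly smaller cardinality.
   [wochoice.well_order] already entails that [r] is a total order. *)
Definition initial_well_order (K : Type) (r : rel K) : Prop :=
  wochoice.well_order r /\
  forall x : K, card_lt [set y : K | r y x /\ y <> x] [set: K].

Definition cofinal (K : Type) (r : rel K) (C : set K) : Prop :=
  forall x : K, exists2 y : K, C y & r x y.

(* [L] has cardinality cf(K): the least cardinality of a cofinal subset of the
   initial ordinal of [K]. As that ordinal is unique up to isomorphism, the
   choice of [r] is immaterial. *)
Definition is_cofinality (K L : Type) : Prop :=
  exists r : rel K, initial_well_order r /\
  exists C : set K,
    [/\ cofinal r C,
        C #= [set: L] &
        forall D : set K, cofinal r D -> C #<= D].

Definition weakly_cauchy (R : realType) (X : normedModType R)
    (x : nat -> X) : Prop :=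
  forall f : {linear X -> R^o}, continuous f -> cvgn (fun n => f (x n)).

Definition equivalent_to_l1_basis (K : Type) (R : realType)
    (X : normedModType R) (D : set X) : Prop :=
  D #= [set: K] /\
  exists C1 C2 : R,
    [/\ 0 < C1, 0 < C2 &
        forall (n : nat) (x : 'I_n -> X) (a : 'I_n -> R),
          injective x -> (forall i, D (x i)) ->
          C1 * (\sum_(i < n) `|a i|) <= `|\sum_(i < n) a i *: x i| /\
          `|\sum_(i < n) a i *: x i| <= C2 * (\sum_(i < n) `|a i|)].

(* Main.v *)
Require Import Defs.
From HB Require Import structures.
From mathcomp Require Import all_boot all_order all_algebra.
From mathcomp Require Import all_classical all_reals all_analysis.
From mathcomp Require wochoice.

(** Identify the elements of [K] with branches [p k : L -> bool] of a binary tree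
    whose height [L] is an infinite cardinal, in such a way that every subset of
    [K] of full cardinality has more than [L] branches. If [K] is not a strong
    limit, [p] is an injection [K -> 2^L] with [L] smaller than [K]; otherwise it
    maps [K] to a cofinal set of cardinality [cf K], which injects into [2^L] for
    some [L] smaller than [cf K].

    Call a set of branches unbalanced if every node splitting it leaves at most
    one branch on one side (a comb), and send [k] to the bounded function
    [chi k] on the subsets of [K] with [chi k F = 1] if [k \in F] and [p @` F] is
    unbalanced, and [0] otherwise. Every infinite subset of [K] contains an infinite
    [F] with [p @` F] unbalanced; given a sequence, an [F] chosen so as to contain
    and to omit infinitely many of its terms is a coordinate along which it
    oscillates. Conversely more than [L] branches contain a
    full binary tree of any depth [n], and an unbalanced set meets its [2 ^ n]
    branches in at most [n + 1] points, so the sum of the corresponding [chi k] has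
    norm at most [n + 1]: no lower [l1] estimate holds. *)

Set Implicit Arguments.
Unset Strict Implicit.
Unset Printing Implicit Defensive.

Import Order.TTheory GRing.Theory Num.Theory.
Import numFieldNormedType.Exports.

Local Open Scope classical_set_scope.
Local Open Scope card_scope.
Local Open Scope ring_scope.

(** * Cardinal arithmetic *)

(** Choice turns the relation [G] into an injection. In this form, injections defined by cases are
    given by a disjunction of their graphs. *)
Lemma card_le_rel (T U : Type) (A : set T) (B : set U) (G : T -> U -> Prop) :
  (forall x, A x -> exists2 y, B y & G x y) ->
  (forall x x' y, A x -> A x' -> G x y -> G x' y -> x = x') -> A #<= B.
Proof.
elim/Ppointed: U => U in B G *.
  move=> tot _; have -> : A = set0; last exact: card_ge0.
  by rewrite -subset0 => x /tot[y]; case: (no y).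
move=> tot inj.
have [f fP] : {f : T -> U & forall x, A x -> B (f x) /\ G x (f x)}.
  apply: (@choice _ _ (fun x y => A x -> B y /\ G x y)) => x.
  have [/tot[y By Gxy]|nAx] := pselect (A x); first by exists y.
  by exists point.
apply/pcard_leP/injfunPex; exists f; first by move=> x /fP[].
move=> x y /set_mem Ax /set_mem Ay fxy.
by apply: (inj _ _ (f x) Ax Ay); [exact: (fP x Ax).2|rewrite fxy; exact: (fP y Ay).2].
Qed.

(** Zorn's lemma yields a maximal partial injection between [A] and [B]. It exhausts [A] or [B],
    since otherwise a pair of unmatched points could be added. *)
Lemma card_le_total (T U : Type) (A : set T) (B : set U) : A #<= B \/ B #<= A.
Proof.
pose P (G : set (T * U)) :=
  [/\ G `<=` A `*` B,
      forall x y y', G (x, y) -> G (x, y') -> y = y' &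
      forall x x' y, G (x, y) -> G (x', y) -> x = x'].
have [|G [[GAB Gfun Ginj] Gmax]] := @Zorn_bigcup _ P.
  move=> F FP Ftot.
  have common u v : (\bigcup_(X in F) X) u -> (\bigcup_(X in F) X) v ->
      exists X, [/\ F X, X u & X v].
    move=> [X FX Xu] [Y FY Yv]; have [XY|YX] := Ftot _ _ FX FY.
      by exists Y; split=> //; exact: XY.
    by exists X; split=> //; exact: YX.
  split=> [u [X FX Xu]|x y y' Gy Gy'|x x' y Gx Gx'].
  - by case: (FP _ FX) => sub _ _; exact: sub.
  - by have [X [/FP[_ fX _] Xy Xy']] := common _ _ Gy Gy'; exact: fX Xy Xy'.
  - by have [X [/FP[_ _ iX] Xx Xx']] := common _ _ Gx Gx'; exact: iX Xx Xx'.
have [totA|/existsNP[a /not_implyP[Aa /forallNP na]]] :=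
    pselect (forall x, A x -> exists y, G (x, y)).
  left; apply: (@card_le_rel _ _ _ _ (fun x y => G (x, y))) => [x /totA[y Gxy]|].
    by exists y => //; have [] := GAB _ Gxy.
  by move=> x x' y _ _; exact: Ginj.
have [totB|/existsNP[b /not_implyP[Bb /forallNP nb]]] :=
    pselect (forall y, B y -> exists x, G (x, y)).
  right; apply: (@card_le_rel _ _ _ _ (fun y x => G (x, y))) => [y /totB[x Gxy]|].
    by exists x => //; have [] := GAB _ Gxy.
  by move=> x x' y _ _; exact: Gfun.
exfalso; apply: (Gmax (G `|` [set (a, b)])).
  split; first by move=> u; left.
  by move=> /(_ (a, b) (or_intror erefl)); exact: na.
split=> [_ [/GAB//|->]|x y y'|x x' y]; first by [].
- move=> [Gy|[xE yE]] [Gy'|[xE' yE']].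
  + exact: Gfun Gy Gy'.
  + by rewrite xE' in Gy; case: (na _ Gy).
  + by rewrite xE in Gy'; case: (na _ Gy').
  + by rewrite yE yE'.
- move=> [Gx|[xE yE]] [Gx'|[xE' yE']].
  + exact: Ginj Gx Gx'.
  + by rewrite yE' in Gx; case: (nb _ Gx).
  + by rewrite yE in Gx'; case: (nb _ Gx').
  + by rewrite xE xE'.
Qed.

(** The graph of an injection from [B * B] to [B]. The base [B] is read off the diagonal, so that
    Zorn's lemma applies to graphs ordered by inclusion. *)
Definition square_embedding (T : Type) (G : set (T * T * T)) : Prop :=
  let B := [set x | exists z, G (x, x, z)] in
  [/\ forall x y z, G (x, y, z) -> [/\ B x, B y & B z],
      forall x y, B x -> B y -> exists z, G (x, y, z),
      forall x y z z', G (x, y, z) -> G (x, y, z') -> z = z' &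
      forall x y x' y' z, G (x, y, z) -> G (x', y', z) -> x = x' /\ y = y'].

Lemma square_embedding_bigcup (T : Type) (F : set (set (T * T * T))) :
  F `<=` @square_embedding T -> total_on F subset ->
  square_embedding (\bigcup_(X in F) X).
Proof.
move=> FP Ftot; set H := \bigcup_(X in F) X.
have common u v : H u -> H v -> exists X, [/\ F X, X u & X v].
  move=> [X FX Xu] [Y FY Yv]; have [XY|YX] := Ftot _ _ FX FY.
    by exists Y; split=> //; exact: XY.
  by exists X; split=> //; exact: YX.
have lift X x : F X -> (exists z, X (x, x, z)) -> exists z, H (x, x, z).
  by move=> FX [z Xz]; exists z; exists X.
split=> [x y z [X FX Xu]|x y [z Hz] [z' Hz']|x y z z' Gz Gz'|x y x' y' z Gz Gz'].
- by have [/(_ _ _ _ Xu)[Bx By Bz] _ _ _] := FP _ FX; split; apply: (lift _ _ FX).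
- have [X [FX Xz Xz']] := common _ _ Hz Hz'.
  have [_ Xtot _ _] := FP _ FX.
  have [w Xw] : exists w, X (x, y, w) by apply: Xtot; [exists z|exists z'].
  by exists w; exists X.
- by have [X [/FP[_ _ fX _] Xz Xz']] := common _ _ Gz Gz'; exact: fX Xz Xz'.
- by have [X [/FP[_ _ _ iX] Xz Xz']] := common _ _ Gz Gz'; exact: iX Xz Xz'.
Qed.

(** The pairing function of the natural numbers, carried along [j], provides a starting point with
    infinite base. *)
Lemma square_embedding_nat (T : Type) (j : nat -> T) : injective j ->
  square_embedding
    [set u | exists m n, u = (j m, j n, j (choice.pickle (m, n)))].
Proof.
move=> jinj; have Bj m : exists z,
    [set u | exists m n, u = (j m, j n, j (choice.pickle (m, n)))] (j m, j m, z).
  by exists (j (choice.pickle (m, m))), m, m.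
split=> /=.
- by move=> x y z [m [n [-> -> ->]]]; split; exact: Bj.
- move=> _ _ [_ [m [_ [-> _ _]]]] [_ [n [_ [-> _ _]]]].
  by exists (j (choice.pickle (m, n))), m, n.
- move=> x y z z' [m [n [-> -> ->]]] [m' [n' [mE nE ->]]].
  by rewrite (jinj _ _ mE) (jinj _ _ nE).
- move=> x y x' y' z [m [n [-> -> ->]]] [m' [n' [-> ->]]].
  by move=> /jinj /(pcan_inj choice.pickleK)[-> ->].
Qed.

Lemma square_embedding_fun (T : Type) (G : set (T * T * T)) :
  let B := [set x | exists z, G (x, x, z)] in
  square_embedding G -> exists f : T -> T -> T,
  [/\ forall x y, B x -> B y -> G (x, y, f x y),
      forall x y, B x -> B y -> B (f x y) &
      forall x y x' y', B x -> B y -> B x' -> B y' ->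
        f x y = f x' y' -> x = x' /\ y = y'].
Proof.
elim/Ppointed: T => T in G *.
  by move=> B _; exists (fun x => match no x with end); split=> x; case: (no x).
move=> B [Gsub Gtot _ Ginj].
have Gtot' u : exists z, B u.1 -> B u.2 -> G (u, z).
  have [[Bx By]|nB] := pselect (B u.1 /\ B u.2).
    by have [z Gz] := Gtot _ _ Bx By; exists z => _ _; case: u Gz {Bx By}.
  by exists point => Bx By; case: nB.
have [f fP] := choice Gtot'.
exists (fun x y => f (x, y)).
have Gf x y : B x -> B y -> G (x, y, f (x, y)) by exact: fP (x, y).
split=> // [x y Bx By|x y x' y' Bx By Bx' By' E].
  by have [] := Gsub _ _ _ (Gf _ _ Bx By).
have := Gf _ _ Bx By; rewrite E => Gz.
exact: Ginj Gz (Gf _ _ Bx' By').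
Qed.

(* With [B] the base of [G] and [C] a disjoint copy of it, the pairs of
   [B `|` C] outside [B `*` B] fall into three copies of [B `*` B], hence embed
   into [C] because [B] absorbs a factor with three elements. *)
Lemma square_embedding_extend (T : Type) (G : set (T * T * T)) (j : nat -> T) :
  let B := [set x | exists z, G (x, x, z)] in
  square_embedding G -> injective j -> range j `<=` B -> B #<= ~` B ->
  exists2 H, square_embedding H & G `<` H.
Proof.
elim/Ppointed: T => T in G j *; first by case: (no (j 0%N)).
move=> B GP jinj jB /pcard_leP/injfunPex[c cN cinj].
have [Gsub Gtot Gfun Ginj] := GP.
have [f [fP Bf finj]] := square_embedding_fun GP.
have cinjB x y : B x -> B y -> c x = c y -> x = y.
  by move=> Bx By; apply: cinj; exact: mem_set.
pose g (s : bool) b := if s then c b else b.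
have ginj s s' b b' : B b -> B b' -> g s b = g s' b' -> s = s' /\ b = b'.
  case: s; case: s' => //= Bb Bb' E.
  - by split=> //; exact: cinjB E.
  - by have := cN _ Bb; rewrite /= E.
  - by have := cN _ Bb'; rewrite /= -E.
pose e (s t : bool) := j (s + t.*2)%N.
have einj s t s' t' : e s t = e s' t' -> s = s' /\ t = t'.
  by move=> /jinj; case: s; case: t; case: s'; case: t'.
have Be s t : B (e s t) by apply: jB; exists (s + t.*2)%N.
have Bff s t b b' : B b -> B b' -> B (f (f b b') (e s t)).
  by move=> Bb Bb'; apply: (Bf); [exact: (Bf)|exact: Be].
pose v s t b b' := c (f (f b b') (e s t)).
pose N := [set u : T * T * T | exists s t b b',
   [/\ s || t, B b, B b' & u = (g s b, g t b', v s t b b')]].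
have NB s t b b' : s || t -> B b -> B b' -> ~ (B (g s b) /\ B (g t b')).
  case: s; first by move=> _ Bb _ [+ _]; exact: cN.
  by case: t => //= _ _ Bb' [_]; exact: cN.
have NBv s t b b' : B b -> B b' -> ~ B (v s t b b').
  by move=> Bb Bb'; apply: cN; exact: (Bff).
have GN x y z : G (x, y, z) -> ~ N (x, y, z).
  move=> /Gsub[Bx By _] [s [t [b [b' [st Bb Bb' [xE yE _]]]]]].
  by apply: (NB s t b b') => //; rewrite -xE -yE.
pose B' := [set x | exists z, (G `|` N) (x, x, z)].
have B'P x : B' x <-> exists s b, B b /\ x = g s b.
  split=> [[z [Gz|[s [_ [b [_ [_ Bb _ [-> _ _]]]]]]]]|[[] [b [Bb ->]]]].
  - by exists false, x; split=> //; exists z.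
  - by exists s, b.
  - by exists (v true true b b); right; exists true, true, b, b.
  - by have [z Gz] := Bb; exists z; left.
exists (G `|` N); last first.
  split; first by move=> u; left.
  have B0 : B (j 0%N) by apply: jB; exists 0%N.
  move=> /(_ (c (j 0%N), c (j 0%N), v true true (j 0%N) (j 0%N))).
  have h : N (c (j 0%N), c (j 0%N), v true true (j 0%N) (j 0%N)).
    by exists true, true, (j 0%N), (j 0%N).
  by move=> /(_ (or_intror h)) /GN.
split.
- move=> x y z [Gz|[s [t [b [b' [st Bb Bb' [-> -> ->]]]]]]].
    have [Bx By Bz] := Gsub _ _ _ Gz.
    by split; apply/B'P; [exists false, x|exists false, y|exists false, z].
  split; apply/B'P; [by exists s, b|by exists t, b'|].
  by exists true, (f (f b b') (e s t)); split=> //; exact: (Bff).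
- move=> x y /B'P[s [b [Bb ->]]] /B'P[t [b' [Bb' ->]]].
  have [st|] := boolP (s || t).
    by exists (v s t b b'); right; exists s, t, b, b'.
  rewrite negb_or => /andP[/negbTE-> /negbTE->].
  by have [z Gz] := Gtot _ _ Bb Bb'; exists z; left.
- move=> x y z z' [Gz|Nz] [Gz'|Nz'].
  + exact: Gfun Gz Gz'.
  + exfalso; case: Nz' => s [t [b [b' [st Bb Bb' [xE yE _]]]]].
    have [Bx By _] := Gsub _ _ _ Gz.
    by apply: (NB s t b b') => //; rewrite -xE -yE.
  + exfalso; case: Nz => s [t [b [b' [st Bb Bb' [xE yE _]]]]].
    have [Bx By _] := Gsub _ _ _ Gz'.
    by apply: (NB s t b b') => //; rewrite -xE -yE.
  + move: Nz Nz' => [s [t [b [b' [st Bb Bb' [-> -> ->]]]]]].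
    move=> [s1 [t1 [b1 [b1' [st1 Bb1 Bb1' []]]]]].
    by move=> /ginj[]// -> -> /ginj[]// -> -> ->.
- move=> x y x' y' z [Gz|Nz] [Gz'|Nz'].
  + exact: Ginj Gz Gz'.
  + exfalso; case: Nz' => s [t [b [b' [st Bb Bb' [_ _ zE]]]]].
    by have [_ _] := Gsub _ _ _ Gz; rewrite zE; exact: NBv.
  + exfalso; case: Nz => s [t [b [b' [st Bb Bb' [_ _ zE]]]]].
    by have [_ _] := Gsub _ _ _ Gz'; rewrite zE; exact: NBv.
  + move: Nz Nz' => [s [t [b [b' [st Bb Bb' [-> -> ->]]]]]].
    move=> [s1 [t1 [b1 [b1' [st1 Bb1 Bb1' [-> ->]]]]]].
    move=> /(cinjB _ _ (Bff _ _ _ _ Bb Bb') (Bff _ _ _ _ Bb1 Bb1')).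
    move=> /(finj _ _ _ _ (Bf _ _ Bb Bb') (Be _ _) (Bf _ _ Bb1 Bb1') (Be _ _)).
    by move=> [/finj[]// -> -> /einj[-> ->]].
Qed.

(** The base [B] of a maximal square embedding does not embed into its complement, by
    [square_embedding_extend]. So the complement embeds into [B], hence [T] embeds into [B], and the
    embedding of [B * B] transfers to [T]. *)
Lemma infinite_square_inj (T : Type) : infinite_set [set: T] ->
  exists f : T * T -> T, injective f.
Proof.
elim/Ppointed: T => T; first by rewrite emptyE => /(_ (finite_set0 _)).
move=> /infiniteP/pcard_injP[j jinj0].
have jinj : injective j by move=> x y; apply: jinj0; exact: mem_set.
pose G0 := [set u | exists m n, u = (j m, j n, j (choice.pickle (m, n)))].
(* The implication admits the empty graph, which is the union of the empty chain; a maximal graph is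
   nonempty and thus contains [G0]. *)
pose P (G : set (T * T * T)) := square_embedding G /\ (G !=set0 -> G0 `<=` G).
have [|G [[GP G0G] Gmax]] := @Zorn_bigcup _ P.
  move=> F FP Ftot; split.
    by apply: square_embedding_bigcup => // X /FP[].
  move=> [u [X FX Xu]] w G0w; exists X => //.
  by have [_] := FP _ FX; apply=> //; exists u.
have {}G0G : G0 `<=` G.
  apply: G0G; apply/set0P/negP => /eqP GE; apply: (Gmax G0); last first.
    by split; [exact: square_embedding_nat jinj|move=> _; exact: subset_refl].
  rewrite GE; split; first exact: sub0set.
  by move=> /(_ (j 0%N, j 0%N, j (choice.pickle (0%N, 0%N)))); apply; exists 0%N, 0%N.
pose B := [set x | exists z, G (x, x, z)].
have jB : range j `<=` B.
  by move=> _ [m _ <-]; exists (j (choice.pickle (m, m))); apply: G0G; exists m, m.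
have [Bsmall|] := card_le_total B (~` B).
  have [H HP GH] := square_embedding_extend GP jinj jB Bsmall.
  case: (Gmax _ GH); split=> // _ u /G0G; exact: (properW GH).
move=> /pcard_leP/injfunPex[d dB dinj].
have [f [_ Bf finj]] := square_embedding_fun GP.
have Bj m : B (j m) by apply: jB; exists m.
(* The tags [j 0] and [j 1] keep the images of [B] and of its complement disjoint. *)
pose h x := if pselect (B x) then f x (j 0%N) else f (d x) (j 1%N).
have Bh x : B (h x).
  by rewrite /h; case: pselect => Bx; apply: (Bf) (Bj _) => //; exact: (dB).
have hinj : injective h.
  move=> x y; rewrite /h; case: pselect => Bx; case: pselect => By E.
  - by have [] := finj _ _ _ _ Bx (Bj _) By (Bj _) E.
  - by have [_ /jinj] := finj _ _ _ _ Bx (Bj _) (dB _ By) (Bj _) E.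
  - by have [_ /jinj] := finj _ _ _ _ (dB _ Bx) (Bj _) By (Bj _) E.
  - have [dE _] := finj _ _ _ _ (dB _ Bx) (Bj _) (dB _ By) (Bj _) E.
    by apply: dinj dE; exact: mem_set.
exists (fun u => f (h u.1) (h u.2)) => -[x y] [x' y'] /= E.
by have [/hinj-> /hinj->] := finj _ _ _ _ (Bh _) (Bh _) (Bh _) (Bh _) E.
Qed.

(** * Branches of binary trees *)

Section WellOrder.
Context (T : Type) (r : rel T) (rwo : wochoice.well_order r).

Lemma well_order_min (A : set T) : A !=set0 ->
  exists2 z, A z & forall x, A x -> r z x.
Proof.
move=> [x Ax]; have [|z [[zA zmin] _]] := rwo (A := [pred x | `[< A x >]]).
  by exists x; apply/asboolP.
exists z; first exact/asboolP.
by move=> y Ay; apply: zmin; apply/asboolP.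
Qed.

(** Totality, antisymmetry and transitivity are read off the minima of sets with at most three
    elements; antisymmetry uses the uniqueness of the minimum. *)
Lemma well_order_total x y : r x y \/ r y x.
Proof.
have [|z [->|->] zmin] := @well_order_min [set x; y]; first by exists x; left.
  by left; apply: zmin; right.
by right; apply: zmin; left.
Qed.

Lemma well_order_anti x y : r x y -> r y x -> x = y.
Proof.
move=> xy yx; have rr z : r z z by case: (well_order_total z z).
have [|z [_ zuniq]] := rwo (A := [pred z | `[< z = x \/ z = y >]]).
  by exists x; apply/asboolP; left.
rewrite -(zuniq x); last by split=> [|_ /asboolP[]->]; [apply/asboolP; left|..].
by apply: zuniq; split=> [|_ /asboolP[]->]; [apply/asboolP; right|..].
Qed.

Lemma well_order_trans x y z : r x y -> r y z -> r x z.
Proof.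
move=> xy yz; have [|w] := @well_order_min [set t | t = x \/ t = y \/ t = z].
  by exists x; left.
move=> wE wmin; have rx := wmin x (or_introl erefl).
have ry := wmin y (or_intror (or_introl erefl)).
have rz := wmin z (or_intror (or_intror erefl)).
case: wE rx ry rz => [->|[->|->]] rx ry rz //.
  by rewrite (well_order_anti xy rx).
by rewrite -(well_order_anti yz ry).
Qed.

(** As [r] is reflexive, the value at [d] is included: [f] and [g] leave the node at [d] on the same
    side. *)
Definition agree (f g : T -> bool) (d : T) : Prop :=
  forall e, r e d -> f e = g e.

(* The node where [a] and [c] split, at or before [delta], has [a] and [b] on one
   side and [c] and [d] on the other. *)
Definition balanced (F : set (T -> bool)) : Prop :=
  exists a b c d delta,
    [/\ [/\ F a, F b, F c & F d], a <> b, c <> d,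
        agree a b delta /\ agree c d delta & a delta <> c delta].

Lemma balanced_subset (F G : set (T -> bool)) : F `<=` G -> balanced F -> balanced G.
Proof.
move=> FG [a [b [c [d [delta [[Fa Fb Fc Fd] ab cd agr ac]]]]]].
by exists a, b, c, d, delta; split=> //; split; exact: FG.
Qed.

(** [delta] is the least node at which any two members of [A] differ; [f] and [g] ensure that there
    is one. *)
Lemma first_difference (A : set (T -> bool)) f g : A f -> A g -> f <> g ->
  exists delta, (exists a b, [/\ A a, A b & a delta <> b delta]) /\
    forall e, r e delta -> e <> delta -> forall a b, A a -> A b -> a e = b e.
Proof.
move=> Af Ag fg.
have [|delta [a [b [Aa Ab ab]]] dmin] :=
    @well_order_min [set e | exists a b, [/\ A a, A b & a e <> b e]].
  have /existsNP[e fge] : ~ forall e, f e = g e by move=> /funext.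
  by exists e, f, g.
exists delta; split; first by exists a, b.
move=> e red ne a' b' Aa' Ab'; apply: contrapT => ne'.
by apply: ne; apply: well_order_anti => //; apply: dmin; exists a', b'.
Qed.

(** At the first node where [I] splits, one side is infinite. Take it as [J], and take [x] from the
    other side. *)
Lemma comb_step (I : set (T -> bool)) : infinite_set I ->
  exists (x : T -> bool) (J : set (T -> bool)) (delta : T),
    [/\ infinite_set J, I x, J `<=` I,
        forall y, J y -> y delta <> x delta &
        forall e, r e delta -> e <> delta ->
          forall a b, I a -> I b -> a e = b e].
Proof.
move=> Iinf; have [f If] := infinite_setN0 Iinf.
have [g [Ig gf]] : exists g, I g /\ f <> g.
  apply: contrapT => /forallNP nog; apply: Iinf.
  apply: (@sub_finite_set _ _ [set f]); last exact: finite_set1.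
  by move=> g Ig /=; apply: contrapT => gf; apply: (nog g); split=> // /esym.
have [delta [[a [b [Ia Ib ab]]] below]] := first_difference If Ig gf.
pose J (c : bool) := I `&` [set y | y delta = c].
have sides : infinite_set (J (b delta)) \/ infinite_set (J (a delta)).
  apply: contrapT => /not_orP[/contrapT fb /contrapT fa]; apply: Iinf.
  apply: (@sub_finite_set _ _ (J (b delta) `|` J (a delta))); last by rewrite finite_setU.
  move=> y Iy; have [yb|yb] := pselect (y delta = b delta); first by left.
  by right; split=> //=; case: (y delta) (a delta) (b delta) ab yb => -[] [].
case: sides => Jinf.
  exists a, (J (b delta)), delta; split=> //; first by move=> y [].
  by move=> y [_ ->] /esym.
exists b, (J (a delta)), delta; split=> //; first by move=> y [].
by move=> y [_ ->].
Qed.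

(** Iterating [comb_step] peels off one branch [x n] at a time: at [delta n] all later branches take
    the other side. The range of [x] is the comb. *)
Lemma infinite_comb (I : set (T -> bool)) : infinite_set I ->
  exists F, [/\ F `<=` I, infinite_set F & ~ balanced F].
Proof.
move=> Iinf; pose S := {J : set (T -> bool) | infinite_set J}.
have [st stP] : {st : S -> (T -> bool) * S * T & forall J : S,
    let: (x, J', delta) := st J in
    [/\ sval J x, sval J' `<=` sval J,
        forall y, sval J' y -> y delta <> x delta &
        forall e, r e delta -> e <> delta ->
          forall a b, sval J a -> sval J b -> a e = b e]}.
  apply: (@choice _ _ (fun (J : S) u => let: (x, J', delta) := u in _)).
  move=> [J Jinf]; have [x [J' [delta [J'inf Jx J'J sep below]]]] := comb_step Jinf.
  by exists (x, exist _ J' J'inf, delta).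
pose J n := iter n (fun K => (st K).1.2) (exist _ I Iinf).
pose x n := (st (J n)).1.1.
pose delta n := (st (J n)).2.
have Jx n : sval (J n) (x n).
  by have := stP (J n); rewrite /x; case: (st (J n)) => -[? ?] ? [].
have JS n : sval (J n.+1) `<=` sval (J n).
  by have := stP (J n); rewrite /=; case: (st (J n)) => -[? ?] ? [].
have sep n y : sval (J n.+1) y -> y (delta n) <> x n (delta n).
  have := stP (J n); rewrite /delta /x /=.
  by case: (st (J n)) => -[? ?] ? [_ _ + _]; apply.
have below n e a b : r e (delta n) -> e <> delta n ->
    sval (J n) a -> sval (J n) b -> a e = b e.
  have := stP (J n); rewrite /delta.
  by case: (st (J n)) => -[? ?] ? [_ _ _ h] re ne; exact: h.
have Jle m n : (m <= n)%N -> sval (J n) `<=` sval (J m).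
  elim: n => [|n IH]; first by rewrite leqn0 => /eqP->.
  rewrite leq_eqVlt => /orP[/eqP->//|/IH]; exact: subset_trans.
have xJ m n : (m <= n)%N -> sval (J m) (x n) by move=> mn; exact: Jle (Jx n).
have xsep m n : (m < n)%N -> x n (delta m) <> x m (delta m).
  by move=> mn; apply: sep; exact: xJ.
have xinj : injective x.
  move=> m n E; have [mn|nm|//] := ltngtP m n.
    by case: (xsep _ _ mn); rewrite E.
  by case: (xsep _ _ nm); rewrite E.
(* The pair with the least index splits at the node [delta i], so [e] lies
   strictly below it, where all later branches agree. *)
have key i j k l e : (i <= j)%N -> (k <= l)%N -> (i <= k)%N -> x i <> x j ->
    agree (x i) (x j) e -> x i e <> x k e -> False.
  move=> ij kl ik nij aij nik.
  have {}ij : (i < j)%N by rewrite ltn_neqAle ij andbT; apply/eqP => E; rewrite E in nij.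
  have nd : ~ r (delta i) e by move=> /aij /esym; exact: xsep.
  have rd : r e (delta i) by case: (well_order_total e (delta i)).
  by apply: nik; apply: (below i) => //; [move=> E; apply: nd; move: rd; rewrite E|exact: xJ].
have keyij i j k l e : (i <= j)%N -> (k <= l)%N -> x i <> x j -> x k <> x l ->
    agree (x i) (x j) e -> agree (x k) (x l) e -> x i e <> x k e -> False.
  move=> ij kl nij nkl aij akl nik; have [ik|/ltnW ki] := leqP i k.
    exact: (key i j k l e).
  by apply: (key k l i j e) => // /esym.
exists (range x); split.
- by move=> _ [n _ <-]; exact: (xJ 0%N n).
- apply/infiniteP; apply: (@card_le_rel _ _ _ _ (fun n y => y = x n)).
    by move=> n _; exists (x n) => //; exists n.
  by move=> m n y _ _ -> /xinj.
move=> [_ [_ [_ [_ [e [[[i _ <-] [j _ <-] [k _ <-] [l _ <-]] nij nkl [aij akl] nik]]]]]].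
have sym f g : agree f g e -> agree g f e by move=> h e' /h.
have ik := aij e; have kl := akl e.
have ree : r e e by case: (well_order_total e e).
have {}ik := ik ree; have {}kl := kl ree.
(* The two members of a pair have the same value at [e], so each pair may be ordered by index. *)
have [ij|/ltnW ij] := leqP i j; have [kl'|/ltnW kl'] := leqP k l.
- exact: (keyij i j k l e).
- by apply: (keyij i j l k e) => //; [move=> /esym|exact: sym|rewrite -kl].
- by apply: (keyij j i k l e) => //; [move=> /esym|exact: sym|rewrite -ik].
- apply: (keyij j i l k e) => //; [by move=> /esym|by move=> /esym|exact: sym|exact: sym|].
  by rewrite -ik -kl.
Qed.

End WellOrder.

(** * Sets of more branches than the height of the tree *)

Section LargeSets.
Context (T : pointedType) (r : rel T) (rwo : wochoice.well_order r).

Definition small (B : set (T -> bool)) : Prop := B #<= [set: T].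

Definition cone (B : set (T -> bool)) f delta := B `&` [set g | agree r f g delta].

(* Otherwise each branch in [B], with at most one exception, has a least node
   [delta] with a small cone; branches with the same [delta] agree below it, so
   they lie in at most two small cones. *)
Lemma large_split (B : set (T -> bool)) : infinite_set [set: T] -> ~ small B ->
  exists f g delta, [/\ ~ small (cone B f delta), ~ small (cone B g delta) &
    f delta <> g delta].
Proof.
move=> Tinf Blarge; apply: contrapT => nosplit.
have split f g e : (forall d, r d e -> ~ small (cone B f d)) ->
    (forall d, r d e -> ~ small (cone B g d)) -> f e <> g e -> False.
  move=> lf lg fg.
  have ree : r e e by case: (well_order_total rwo e e).
  by apply: nosplit; exists f, g, e; split; [exact: lf|exact: lg|].
have [q qinj] := infinite_square_inj Tinf.
have /infiniteP/pcard_injP[j jinj0] := Tinf.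
have jinj : injective j by move=> m n; apply: jinj0; exact: mem_set.
(* [phi S] numbers the members of each small set [S] by elements of [T]. *)
have [phi phiP] : {phi : set (T -> bool) -> (T -> bool) -> T &
    forall S, small S -> {in S &, injective (phi S)}}.
  apply: (@choice _ _ (fun S h => small S -> {in S &, injective h})) => S.
  have [/pcard_injP[h hinj]|nS] := pselect (small S); first by exists h.
  by exists (fun=> point) => /nS.
(* Here [d] is the least node at which [f] has a small cone. [code f d] records [d], the side taken
   there and the number of [f] in that cone; the tag [j 2] keeps [code0], meant for a branch with
   large cones only, apart from these. *)
pose lonely f d := small (cone B f d) /\
  forall e, r e d -> e <> d -> ~ small (cone B f e).
pose code f d := q (q (d, j (nat_of_bool (f d))), phi (cone B f d) f).
pose code0 := q (q (point, j 2%N), point).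
pose G f t := (forall d, ~ small (cone B f d)) /\ t = code0 \/
  exists2 d, lonely f d & t = code f d.
have codeN f d : code f d <> code0.
  by move=> /qinj[/qinj[_ /jinj]]; case: (f d).
apply: Blarge; apply: (@card_le_rel _ _ _ _ G) => [f Bf|f g t Bf Bg].
  have [nf|/existsNP[d /contrapT fd]] :=
      pselect (forall d, ~ small (cone B f d)).
    by exists code0 => //; left.
  have [|e fe emin] := well_order_min rwo (A := [set d | small (cone B f d)]).
    by exists d.
  exists (code f e) => //; right; exists e => //; split=> // e' re' ne' fe'.
  by apply: ne'; apply: (well_order_anti rwo) => //; exact: emin.
move=> [[nf ->]|[d [fd ltd] ->]] [[ng tE]|[d' [gd gltd] tE]].
- apply: contrapT => fg; have /existsNP[e fge] : ~ forall e, f e = g e.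
    by move=> /funext.
  exact: (split f g e).
- by case: (codeN g d').
- by case: (codeN f d).
move: tE => /qinj[/qinj[dE /jinj fgd] phiE]; rewrite -dE in gd gltd fgd phiE.
have {}fgd : f d = g d by move: fgd; case: (f d); case: (g d).
(* Strictly below [d] all cones of [f] and [g] are large, so a difference there would contradict
   [nosplit]. *)
have fg : agree r f g d.
  move=> e re; have [->//|ne] := pselect (e = d).
  apply: contrapT => fge; apply: (split f g e) => // e' re'.
    apply: ltd; first exact: (well_order_trans rwo re' re).
    by move=> E; apply: ne; apply: (well_order_anti rwo) => //; rewrite -E.
  apply: gltd; first exact: (well_order_trans rwo re' re).
  by move=> E; apply: ne; apply: (well_order_anti rwo) => //; rewrite -E.
have coneE : cone B f d = cone B g d.
  by apply/seteqP; split=> h [Bh ah]; split=> // e re; rewrite -(ah e re) (fg e re).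
rewrite -coneE in phiE; apply: phiP phiE => //; apply: mem_set; split=> //.
Qed.

(* A full binary tree of depth [n] is the witness. *)
Lemma large_tree (n : nat) (B : set (T -> bool)) :
  infinite_set [set: T] -> ~ small B ->
  exists s : seq (T -> bool),
    [/\ uniq s, forall f : T -> bool, f \in s -> B f, size s = (2 ^ n)%N &
        forall P : pred (T -> bool),
          ~ balanced r [set f | f \in s /\ P f] -> (count P s <= n.+1)%N].
Proof.
move=> Tinf; elim: n B => [|n IH] B Blarge.
  have [f Bf] : B !=set0.
    by apply/set0P/negP => /eqP BE; apply: Blarge; rewrite BE; exact: card_ge0.
  exists [:: f]; split=> // [g|P _]; first by rewrite inE => /eqP->.
  by rewrite (leq_trans (count_size _ _)).
have [f [g [d [fl gl fg]]]] := large_split Tinf Blarge.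
have [s [us sB ss sP]] := IH _ fl; have [t [ut tB ts tP]] := IH _ gl.
have st (a b : T -> bool) : a \in s -> b \in t -> a d <> b d.
  move=> /sB[_ ah] /tB[_ bh]; have rdd : r d d by case: (well_order_total rwo d d).
  by rewrite -(ah d rdd) -(bh d rdd).
exists (s ++ t); split.
- rewrite cat_uniq us ut andbT /=; apply/hasPn => a /= at_; apply/negP => as_.
  exact: (st a a).
- by move=> a; rewrite mem_cat => /orP[/sB[]|/tB[]].
- by rewrite size_cat ss ts addnn -mul2n expnS.
move=> P nb; rewrite count_cat.
have cs : (count P s <= n.+1)%N.
  apply: sP => bs; apply: nb; apply: balanced_subset bs => a [as_ Pa].
  by split=> //; rewrite mem_cat as_.
have ct : (count P t <= n.+1)%N.
  apply: tP => bt; apply: nb; apply: balanced_subset bt => a [at_ Pa].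
  by split=> //; rewrite mem_cat at_ orbT.
have two (u : seq (T -> bool)) : uniq u -> (1 < count P u)%N ->
    exists a b, [/\ a \in u /\ P a, b \in u /\ P b & a <> b].
  move=> uu; rewrite -size_filter; have := filter_uniq P uu.
  case E : (seq.filter P u) => [|a [|b w]] //= /andP[abw _] _.
  have memE (x : T -> bool) : x \in seq.filter P u -> x \in u /\ P x.
    by rewrite mem_filter => /andP[].
  exists a, b; split; [apply: memE|apply: memE|]; rewrite ?E ?inE ?eqxx ?orbT //.
  by move=> ab; rewrite ab inE eqxx in abw.
(* If one half contains at most one point of [P], the bound [n.+1] for the other half grows by at
   most one. Two points in each half would form a balanced configuration at [d]. *)
have [s1|s1] := leqP (count P s) 1.
  by rewrite (leq_trans (leq_add s1 ct)).
have [t1|t1] := leqP (count P t) 1.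
  by rewrite (leq_trans (leq_add cs t1)) ?addn1.
case: nb; have [a [b [[as_ Pa] [bs Pb] ab]]] := two _ us s1.
have [a' [b' [[at_ Pa'] [bt Pb'] ab']]] := two _ ut t1.
exists a, b, a', b', d; split=> //; last exact: st.
  by split; split; rewrite // mem_cat ?as_ ?bs ?at_ ?bt ?orbT.
have [_ ah] := sB _ as_; have [_ bh] := sB _ bs.
have [_ a'h] := tB _ at_; have [_ b'h] := tB _ bt.
by split=> e re; [rewrite -(ah e re) (bh e re)|rewrite -(a'h e re) (b'h e re)].
Qed.

End LargeSets.

(** * The Banach space of bounded functions *)

Section BoundedFunctions.
Context (S : Type) (R : realType).

Definition bounded_pred : {pred S -> R} :=
  mem [set f | exists M, forall s, `|f s| <= M].

Record bfun := BFun { bfun_val :> S -> R; bfunP : bfun_val \in bounded_pred }.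

HB.instance Definition _ := [isSub for bfun_val].
HB.instance Definition _ := [Choice of bfun by <:].

Lemma bounded_submod_closed : GRing.submod_closed bounded_pred.
Proof.
split=> [|a f g]; rewrite !inE /=; first by exists 0 => s; rewrite normr0.
move=> [M fM] [N gN]; exists (`|a| * M + N) => s.
by rewrite (le_trans (ler_normD _ _))// lerD// normrM ler_wpM2l.
Qed.

HB.instance Definition _ :=
  GRing.isSubmodClosed.Build R (S -> R) bounded_pred bounded_submod_closed.
HB.instance Definition _ := [SubChoice_isSubLmodule of bfun by <:].

Definition sup_norm (f : bfun) : R := sup (range (fun s => `|f s|)).

Lemma ler_sup_norm (f : bfun) s : `|f s| <= sup_norm f.
Proof.
have /set_mem[M fM] := bfunP f.
apply: sup_upper_bound; last by exists s.
by split; [exists `|f s|, s|exists M => _ [t _ <-]].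
Qed.

(** The condition [0 <= M] covers an empty [S], where the supremum is [0] by convention. *)
Lemma sup_norm_le (f : bfun) M : 0 <= M -> (forall s, `|f s| <= M) -> sup_norm f <= M.
Proof.
move=> M0 fM; rewrite /sup_norm.
have [->|/set0P A0] := eqVneq [set `|f s| | s in setT] set0; first by rewrite sup0.
by apply: ge_sup => // _ [s _ <-].
Qed.

Lemma sup_norm_ge0 (f : bfun) : 0 <= sup_norm f.
Proof.
have [A0|/set0P[_ [s _ _]]] := eqVneq (range (fun s => `|f s|)) set0.
  by rewrite /sup_norm A0 sup0.
exact: le_trans (normr_ge0 _) (ler_sup_norm f s).
Qed.

Lemma ler_sup_normD f g : sup_norm (f + g) <= sup_norm f + sup_norm g.
Proof.
apply: sup_norm_le => [|s]; first by rewrite addr_ge0 ?sup_norm_ge0.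
by rewrite (le_trans (ler_normD _ _))// lerD// ler_sup_norm.
Qed.

Lemma sup_normZ (a : R) f : sup_norm (a *: f) = `|a| * sup_norm f.
Proof.
apply/eqP; rewrite eq_le; apply/andP; split.
  apply: sup_norm_le => [|s]; first by rewrite mulr_ge0 ?sup_norm_ge0.
  by rewrite normrM ler_wpM2l// ler_sup_norm.
have [->|a0] := eqVneq a 0; first by rewrite normr0 mul0r sup_norm_ge0.
have a_gt0 : 0 < `|a| by rewrite normr_gt0.
rewrite mulrC -ler_pdivlMr//; apply: sup_norm_le => [|s].
  by rewrite divr_ge0 ?sup_norm_ge0.
by rewrite ler_pdivlMr// mulrC -normrM; exact: (ler_sup_norm (a *: f)).
Qed.

Lemma sup_norm_eq0 f : sup_norm f = 0 -> f = 0.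
Proof.
move=> f0; apply/val_inj/funext => s; apply/eqP; rewrite -normr_le0 -f0.
exact: ler_sup_norm.
Qed.

HB.instance Definition _ :=
  Lmodule_isNormed.Build R bfun ler_sup_normD sup_normZ sup_norm_eq0.

Lemma bfun_normE (f : bfun) : `|f| = sup_norm f.
Proof. by []. Qed.

(** The evaluations are the functionals that will witness the failure of weak Cauchyness. *)
Definition ev (s : S) (f : bfun) : R^o := f s.

Lemma ev_linear s : linear (ev s).
Proof. by []. Qed.

HB.instance Definition _ s := GRing.isLinear.Build R bfun R^o _ (ev s) (ev_linear s).

Lemma ev_continuous s : continuous (ev s).
Proof.
apply: (bounded_linear_continuous (f := ev s : {linear bfun -> R^o})).
apply/linear_boundedP.
near=> M => f; rewrite (le_trans (ler_sup_norm f s))// -bfun_normE ler_peMl//.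
Unshelve. all: by end_near. Qed.

(** Evaluations do not increase distances, so a Cauchy filter converges pointwise; the convergence
    is uniform, which makes the limit bounded. *)
Lemma bfun_complete (F : set_system bfun) : ProperFilter F -> cauchy F -> cvg F.
Proof.
move=> FF /cauchy_ballP Fc.
have evc s : cvg (ev s @ F).
  apply: R_complete; apply: cauchy_exP => e e0.
  have /cauchy_ballP/cauchyP/(_ _ e0)[f Ff] := Fc.
  exists (f s).
  apply: (@filterS _ F _ (ball f e) (ev s @^-1` ball (f s) e)) Ff => g.
  rewrite /= -!ball_normE /= => fg.
  exact: (le_lt_trans (ler_sup_norm (f - g) s) fg).
pose l s : R := lim (ev s @ F).
(* A filter set of diameter [e] stays within [e] of [l], uniformly in [s]. *)
have near_l (e : R) : 0 < e ->
    \forall f \near F, forall s, `|l s - bfun_val f s| <= e.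
  move=> e0; have e20 : 0 < e / 2 by rewrite divr_gt0.
  have near2 := nearP_dep (Fc _ e20); near=> f => s.
  near F => g; rewrite (splitr e) (le_trans (ler_distD (g s) _ _))// lerD//.
    near: g; have /cvgrPdist_le evl : ev s @ F --> l s := evc s.
    exact: evl.
  rewrite distrC (le_trans (ler_sup_norm (f - g) s))// -bfun_normE ltW//.
  have : ball f (e / 2) g by near: g; near: f; exact: near2.
  by rewrite -ball_normE.
have lP : l \in bounded_pred.
  near F => f; rewrite inE; exists (1 + `|f|) => s.
  rewrite -[l s](subrK (f s)) (le_trans (ler_normD _ _))// lerD ?ler_sup_norm//.
  by move: s; near: f; exact: near_l.
apply/cvg_ex; exists (BFun lP); apply/cvgrPdist_le => e e0.
near=> f; rewrite bfun_normE; apply: sup_norm_le => [|s]; first exact: ltW.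
by move: s; near: f; exact: near_l.
Unshelve. all: by end_near. Qed.

HB.instance Definition _ := Uniform_isComplete.Build bfun bfun_complete.

Definition linf : completeNormedModType R := bfun.
End BoundedFunctions.

(** * The example *)

Lemma infinite_range (U : Type) (u : nat -> U) : injective u -> infinite_set (range u).
Proof.
move=> uinj; apply/infiniteP; apply: (@card_le_rel _ _ _ _ (fun n y => y = u n)).
  by move=> n _; exists (u n) => //; exists n.
by move=> m n y _ _ -> /uinj.
Qed.

(** If [I] meets finitely many branches, some fibre of [p] in [I] is infinite, and a single branch
    is unbalanced. Otherwise the preimage in [I] of an infinite comb serves. *)
Lemma infinite_unbalanced (T : pointedType) (r : rel T) (K : Type)
    (p : K -> T -> bool) (I : set K) :
  wochoice.well_order r -> infinite_set I ->
  exists F, [/\ F `<=` I, infinite_set F & ~ balanced r (p @` F)].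
Proof.
move=> rwo Iinf; have [pIfin|pIinf] := pselect (finite_set (p @` I)).
  have [v vinf] : exists v, infinite_set (I `&` [set k | p k = v]).
    apply: contrapT => /forallNP fin; apply: Iinf.
    apply: (@sub_finite_set _ _
      (\bigcup_(v in p @` I) (I `&` [set k | p k = v]))).
      by move=> k Ik; exists (p k) => //; exists k.
    by apply: bigcup_finite => // v _; exact: (contrapT (fin v)).
  exists (I `&` [set k | p k = v]); split=> //.
  move=> [_ [_ [c [d [e [[[a [_ /= av] <-] [b [_ /= bv] <-] _ _] ab _ _ _]]]]]].
  by apply: ab; rewrite av bv.
have [C [CI Cinf Cb]] := infinite_comb rwo pIinf.
have CE : p @` (I `&` [set k | C (p k)]) = C.
  apply/seteqP; split=> [_ [k [_ Ck] <-]//|f Cf].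
  by have [k Ik kf] := CI _ Cf; exists k => //; split; rewrite //= kf.
exists (I `&` [set k | C (p k)]); split; first exact: subIsetl.
  by move=> fin; apply: Cinf; rewrite -CE; exact: finite_image.
by rewrite CE.
Qed.

Lemma exp2_linear_bound (R : realType) (C : R) :
  (forall n, C * (2 ^ n)%:R <= n.+1%:R) -> C <= 0.
Proof.
move=> Cn; rewrite leNgt; apply/negP => C0.
(* For [n = m + m] the factors [C * 2 ^ m] and [2 ^ m] are at least [2] and [m + 1], and
   [2 * (m + 1)] exceeds [n + 1]. *)
pose m := (Num.truncn (2 / C)).+1.
have Cm : 2 < C * m%:R by rewrite mulrC -ltr_pdivrMr// truncnS_gt.
have mn : (m.+1%:R : R) <= (2 ^ m)%:R by rewrite ler_nat ltn_expl.
have := Cn (m + m)%N; apply/negP; rewrite -ltNge expnD natrM mulrA.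
apply: (@lt_le_trans _ _ (2 * m.+1%:R)).
  by rewrite -natrM ltr_nat mul2n -addnn addSn addnS.
apply: ler_pM => //; apply: ltW (lt_le_trans Cm _); rewrite ler_wpM2l ?(ltW C0)//.
by apply: le_trans mn; rewrite ler_nat.
Qed.

Section Example.
Context (R : realType) (K : Type) (T : pointedType) (r : rel T).
Context (rwo : wochoice.well_order r) (p : K -> T -> bool).

Definition chi (k : K) : set K -> R :=
  fun F => (`[< F k /\ ~ balanced r (p @` F) >])%:R.

Lemma chi_bounded k : chi k \in @bounded_pred (set K) R.
Proof.
by rewrite inE; exists 1 => F; rewrite normr_nat lern1 leq_b1.
Qed.

Definition chi_linf k : linf (set K) R := BFun (chi_bounded k).

(** A singleton is unbalanced, so the coordinate [[set k]] separates [k] from every other index. *)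
Lemma chi_linf_inj : injective chi_linf.
Proof.
move=> k k' E; have : chi k [set k] = chi k' [set k].
  by rewrite -[chi k]/(bfun_val (chi_linf k)) E.
rewrite /chi; have nb : ~ balanced r (p @` [set k]).
  by rewrite image_set1 => -[a [b [c [d [e [[-> -> _ _] /(_ erefl)]]]]]].
have -> : `[< [set k] k /\ ~ balanced r (p @` [set k]) >] = true by apply/asboolP.
by case: asboolP => [[->]//|_ /eqP]; rewrite oner_eq0.
Qed.

Lemma chi_linf_not_weakly_cauchy (k : nat -> K) :
  injective k -> ~ weakly_cauchy (chi_linf \o k).
Proof.
move=> kinj wc.
have [F [Fk Finf Fnb]] := infinite_unbalanced p rwo (infinite_range kinj).
have /infiniteP/pcard_leP/injfunPex[u uF uinj0] : infinite_set [set n | F (k n)].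
  move=> fin; apply: Finf; apply: (@sub_finite_set _ _ (k @` [set n | F (k n)])).
    by move=> x Fx; have [n _ nx] := Fk _ Fx; exists n => //; rewrite /= nx.
  exact: finite_image.
have uinj : injective u by move=> m n; apply: uinj0; exact: mem_set.
(* Keeping every other listed term of [F] leaves infinitely many terms inside [F'] and infinitely
   many outside. *)
pose F' := range (fun n => k (u n.*2)).
have F'nb : ~ balanced r (p @` F').
  apply: contra_not Fnb; apply: balanced_subset; apply: image_subset.
  by move=> _ [n _ <-]; exact: uF.
(* [u] is injective but perhaps not increasing; injectivity still provides terms of arbitrarily
   large index. *)
have large (v : nat -> nat) N : injective v -> exists n, (N <= v n)%N.
  by move=> vinj; have [n nN] := injective_gtn vinj N; exists n; exact: ltnW.
have half_gt0 : 0 < 1 / 2 :> R by rewrite divr_gt0.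
have /cvg_ex[l /cvgrPdist_lt/(_ _ half_gt0)[N _ near_l]] :=
  wc (@ev (set K) R F') (@ev_continuous _ _ F').
have [m mN] : exists n, (N <= u n.*2)%N.
  by apply: (large (fun n => u n.*2)) => a b /uinj /double_inj.
have [n nN] : exists n, (N <= u n.*2.+1)%N.
  by apply: (large (fun n => u n.*2.+1)) => a b /uinj [/double_inj].
have em : ev F' (chi_linf (k (u m.*2))) = 1.
  rewrite /ev /= /chi; case: asboolP => // -[]; split=> //; by exists m.
have en : ev F' (chi_linf (k (u n.*2.+1))) = 0.
  rewrite /ev /= /chi; case: asboolP => // -[[b _ /kinj /uinj E] _].
  by have := congr1 odd E; rewrite /= !odd_double.
have lm : `|l - 1| < 1 / 2 by rewrite -[X in l - X]em; exact: (near_l _ mN).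
have ln : `|l - 0| < 1 / 2 by rewrite -[X in l - X]en; exact: (near_l _ nN).
(* The values [1] and [0] are both taken arbitrarily late, so both would lie within [1 / 2] of the
   limit [l]. *)
have : (1 : R) < 1 / 2 + 1 / 2.
  apply: le_lt_trans (ltrD ln lm).
  have dist1 : `|(l - 0) - (l - 1)| = 1.
    by rewrite subr0 opprB addrC subrK normr1.
  rewrite -[leLHS]dist1.
  exact: ler_normB.
by rewrite -splitr ltxx.
Qed.

Lemma chi_linf_norm k : `|chi_linf k| <= 1.
Proof. by apply: sup_norm_le => // F; rewrite normr_nat lern1 leq_b1. Qed.

Lemma bfun_sumE (S : Type) n (f : 'I_n -> linf S R) s :
  bfun_val (\sum_(i < n) f i) s = \sum_(i < n) bfun_val (f i) s.
Proof. by elim/big_rec2: _ => //= i y x _ <-. Qed.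

Lemma chi_linf_not_l1 (D : set (linf (set K) R)) :
  infinite_set [set: T] ->
  (forall E : set K, E #= [set: K] -> ~ (p @` E #<= [set: T])) ->
  D `<=` range chi_linf -> ~ equivalent_to_l1_basis K D.
Proof.
move=> Tinf plarge Dchi [DK [C1 [C2 [C1_gt0 _ l1]]]].
suff : C1 <= 0 by rewrite leNgt C1_gt0.
apply: exp2_linear_bound => n.
pose E := chi_linf @^-1` D.
have EK : E #= [set: K].
  apply: card_eq_trans DK; apply: card_esym.
  have -> : D = chi_linf @` E.
    apply/seteqP; split=> [x Dx|_ [k Ek <-]//].
    by have [k _ kx] := Dchi _ Dx; exists k => //; rewrite /E /= kx.
  by apply: inj_card_eq => x y _ _; exact: chi_linf_inj.
have [s [us sE ss scount]] := large_tree rwo n Tinf (plarge _ EK).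
have [k0 _] : E !=set0.
  have /sE[k Ek _] : nth (fun=> false) s 0 \in s by rewrite mem_nth // ss expn_gt0.
  by exists k.
(* [g] picks one index in [E] for each branch of the tree [s]. *)
have [g gP] : {g : (T -> bool) -> K & forall f, f \in s -> E (g f) /\ p (g f) = f}.
  apply: (@choice _ _ (fun f k => f \in s -> E k /\ p k = f)) => f.
  by have [/sE[k Ek kf]|] := boolP (f \in s); [exists k|exists k0].
pose x (i : 'I_(2 ^ n)) := nth (fun=> false) s i.
have xs i : x i \in s by rewrite mem_nth // ss.
have xinj : injective (fun i => chi_linf (g (x i))).
  move=> i j /chi_linf_inj /(congr1 p); rewrite !(gP _ (xs _)).2 => /eqP.
  by rewrite nth_uniq ?ss// => /eqP/val_inj.
have [+ _] := l1 _ _ (fun=> 1) xinj (fun i => (gP _ (xs i)).1).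
rewrite (eq_bigr (fun=> 1)); last by move=> i _; rewrite normr1.
rewrite sumr_const card_ord => /le_trans; apply.
under eq_bigr do rewrite scale1r.
apply: sup_norm_le => // F; rewrite bfun_sumE /= /chi -natr_sum normr_nat ler_nat.
(* At a balanced coordinate the sum vanishes. At an unbalanced one it counts branches of [s] that
   lie in the image of [F], hence is at most [n.+1]. *)
have [Fb|Fnb] := pselect (balanced r (p @` F)).
  by rewrite big1 // => i _; case: asboolP => // -[].
pose P f := `[< F (g f) >].
apply: (@leq_trans (count P s)); last first.
  apply: scount; apply: contra_not Fnb; apply: balanced_subset => f [fs /asboolP Fgf].
  by exists (g f) => //; exact: (gP _ fs).2.
rewrite -sum1_count (big_nth (fun=> false)) ss big_mkord [leqRHS]big_mkcond /=.
apply: leq_sum => i _; rewrite /P; case: asboolP => // -[Fi _].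
by rewrite asboolT.
Qed.

End Example.

(** All that is needed of the cardinals is an infinite height [T] and a map to branches under which
    sets of full cardinality have more than [T] images. *)
Lemma cardinal_example (R : realType) (K : Type) (T : pointedType)
    (p : K -> T -> bool) :
  infinite_set [set: T] ->
  (forall E : set K, E #= [set: K] -> ~ (p @` E #<= [set: T])) ->
  exists (X : completeNormedModType R) (A : set X),
    [/\ bounded_set A,
        A #= [set: K],
        forall x : nat -> X,
          injective x -> (forall n : nat, A (x n)) -> ~ weakly_cauchy x &
        forall D : set X, D `<=` A -> ~ equivalent_to_l1_basis K D].
Proof.
move=> Tinf plarge.
have [r rwo] : exists r : rel T, wochoice.well_order r.
  by have [r rwo] := wochoice.well_ordering_principle T; exists r.
exists (linf (set K) R), (range (chi_linf R r p)); split.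
- exists 1; split; first exact: real1.
  by move=> M M1 _ [k _ <-]; exact: le_trans (chi_linf_norm _ _ _ _) (ltW M1).
- by apply: inj_card_eq => x y _ _; exact: chi_linf_inj.
- move=> x xinj xA.
  have [k kx] : {k : nat -> K & forall n, chi_linf R r p (k n) = x n}.
    apply: (@choice _ _ (fun n k => chi_linf R r p k = x n)) => n.
    by have [k _ kx] := xA n; exists k.
  have -> : x = chi_linf R r p \o k by apply/funext => n; rewrite /= kx.
  apply: chi_linf_not_weakly_cauchy => // m n E; apply: xinj.
  by rewrite -!kx E.
- by move=> D; exact: chi_linf_not_l1.
Qed.

(** * Cardinals that are not strong limits *)

Lemma card_le_pow (K L : Type) : ~ card_lt [set: set L] [set: K] ->
  [set: K] #<= [set: L -> bool].
Proof.
move=> nlt; have KL : [set: K] #<= [set: set L].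
  have [//|LK] := card_le_total [set: K] [set: set L].
  apply: contrapT => nKL; apply: nlt; split=> // E.
  by apply: nKL; rewrite (card_le_eqr E).
apply: card_le_trans KL _.
apply: (@card_le_rel _ _ _ _ (fun A f => f = fun l => `[< A l >])) => [A _|A B f _ _ -> E].
  by exists (fun l => `[< A l >]).
by apply/predeqP => l; apply: asbool_eq_equiv; exact: (congr1 (@^~ l) E).
Qed.

(** A finite [L] injects into some ['I_n], and then a function on [L] is determined by one of the
    finitely many functions on ['I_n]. *)
Lemma infinite_pow (L : Type) : infinite_set [set: L -> bool] -> infinite_set [set: L].
Proof.
apply: contra_not => /finite_set_leP[n /pcard_leP/injfunPex[g gn ginj]].
apply: (@card_le_finite _ {ffun 'I_n -> bool} _ setT); last exact: finite_finset.
apply: (@card_le_rel _ _ _ _ (fun f (phi : {ffun 'I_n -> bool}) =>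
    forall l (gl : (g l < n)%N), phi (Ordinal gl) = f l)) => [f _|f f' phi _ _ fphi f'phi].
  exists [ffun i : 'I_n => `[< exists2 l, g l = i & f l >]] => // l gl.
  rewrite ffunE; apply/asboolP/idP => [[l' /ginj ll' fl']|fl]; last by exists l.
  by rewrite -ll' ?inE.
by apply/funext => l; have gl := gn l I; rewrite -(fphi l gl) -(f'phi l gl).
Qed.

(** The elements strictly below a maximum [x] would be all of [K] but [x]; as [K] is infinite, this
    proper initial segment would have the cardinality of [K]. *)
Lemma initial_no_max (K : Type) (r : rel K) (x : K) :
  initial_well_order r -> infinite_set [set: K] -> exists2 y, r x y & y <> x.
Proof.
move=> [rwo seg] Kinf; apply: contrapT => nomax.
have below y : y <> x -> r y x.
  move=> yx; have [//|xy] := well_order_total rwo y x.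
  by case: nomax; exists y.
set S := [set y | r y x /\ y <> x].
have Sinf : infinite_set S.
  move=> Sfin; apply: Kinf; apply: (@sub_finite_set _ _ (S `|` [set x])).
    by move=> y _; have [->|yx] := pselect (y = x); [right|left; split=> //; exact: below].
  by rewrite finite_setU; split=> //; exact: finite_set1.
have [SK] := seg x; apply; rewrite card_eq_le SK /=.
elim/Ppointed: K => K in r x rwo seg Kinf nomax below S Sinf SK *.
  by case: (no x).
have /infiniteP/pcard_leP/injfunPex[j jS jinj0] := Sinf.
have jinj : injective j by move=> m n; apply: jinj0; exact: mem_set.
(* Hilbert's hotel: [x] moves to [j 0], each [j n] to [j n.+1], and all other points stay. *)
apply: (@card_le_rel _ _ _ _ (fun y z => [\/ y = x /\ z = j 0%N,
  exists2 n, y = j n & z = j n.+1 |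
  [/\ y <> x, ~ range j y & z = y]])) => [y _|y y' z _ _].
  have [->|yx] := pselect (y = x); first by exists (j 0%N); [exact: jS|exact: Or31].
  have [[n _ <-]|jy] := pselect (range j y).
    by exists (j n.+1); [exact: jS|apply: Or32; exists n].
  by exists y; [split=> //; exact: below|exact: Or33].
case=> [[-> ->]|[n -> ->]|[yx jy ->]]; case=> [[-> E]|[n' -> E]|[yx' jy' E]] //.
- by have := jinj _ _ E.
- by case: jy'; rewrite -E; exists 0%N.
- by have := jinj _ _ E.
- by have [->] := jinj _ _ E.
- by case: jy'; rewrite -E; exists n.+1.
- by case: jy; rewrite E; exists 0%N.
- by case: jy; rewrite E; exists n'.+1.
Qed.

Lemma finite_upper_bound (K : Type) (r : rel K) (x : K) (C : set K) :
  wochoice.well_order r -> finite_set C -> exists u, forall c, C c -> r c u.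
Proof.
elim/Peq: K => K in r x C *; move=> rwo /finite_seqP[s ->].
elim: s => [|a s [u su]]; first by exists x.
have [au|ua] := well_order_total rwo a u.
  by exists u => c /=; rewrite inE => /orP[/eqP->//|/su].
exists a => c /=; rewrite inE => /orP[/eqP->|/su cu].
  by case: (well_order_total rwo a a).
exact: well_order_trans rwo _ _ _ cu ua.
Qed.

Theorem mainTheorem1 (R : realType) (K cfK : Type)
    (hK : ~ countable [set: K])
    (hcf : is_cofinality K cfK)
    (hsl : ~ (strong_limit K /\ strong_limit cfK)) :
  exists (X : completeNormedModType R) (A : set X),
    [/\ bounded_set A,
        A #= [set: K],
        forall x : nat -> X,
          injective x -> (forall n : nat, A (x n)) -> ~ weakly_cauchy x &
        forall D : set X, D `<=` A -> ~ equivalent_to_l1_basis K D].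
Proof.
have Kinf : infinite_set [set: K] by move=> /finite_set_countable.
have [k0 _] := infinite_setN0 Kinf.
suff [L [p [Linf plarge]]] : exists (L : Type) (p : K -> L -> bool),
    infinite_set [set: L] /\
    forall E : set K, E #= [set: K] -> ~ (p @` E #<= [set: L]).
  elim/Ppointed: L => L in p Linf plarge *; last exact: cardinal_example plarge.
  by have [l] := infinite_setN0 Linf; case: (no l).
(* Whichever of [K] and [cfK] is not a strong limit is larger than some [L] but injects into
   [L -> bool]. *)
move: hsl => /not_andP[|] /existsNP[L /not_implyP[[LK LnK] /card_le_pow]].
  (* Here [p] is injective, so a set of full cardinality has an image of cardinality [K], larger
     than [L]. *)
  move=> KL; exists L; have /pcard_injP[p pinj] := KL; exists p; split.
    apply: infinite_pow => fin; exact: Kinf (card_le_finite KL fin).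
  move=> E EK pEL; apply: LnK; rewrite card_eq_le LK /=.
  apply: card_le_trans pEL; rewrite -(card_le_eql EK) (card_le_eqr (inj_card_eq _)) //.
  by move=> x y _ _; apply: pinj; exact: mem_set.
move=> cfL; have [r [[rwo seg] [C [Ccof Ccf Cmin]]]] := hcf.
have CL : C #<= [set: L -> bool] by rewrite (card_le_eql Ccf).
have /pcard_injP[q qinj] := CL.
(* [c] moves each point up to the cofinal set [C], whose elements [q] turns into distinct
   branches. *)
have [c cP] : {c : K -> K & forall x, C (c x) /\ r x (c x)}.
  by apply: (@choice _ _ (fun x y => C y /\ r x y)) => x; have [y] := Ccof x; exists y.
exists L, (q \o c); split.
  (* A finite [C] would be bounded by some [u], and an element strictly above [u] contradicts
     cofinality. *)
  apply: infinite_pow => fin; have Cfin := card_le_finite CL fin.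
  have [u Cu] := finite_upper_bound k0 rwo Cfin.
  have [y uy yu] := initial_no_max u (conj rwo seg) Kinf.
  have [z Cz yz] := Ccof y; apply: yu; apply: (well_order_anti rwo) => //.
  exact: (well_order_trans rwo yz (Cu _ Cz)).
move=> E EK; rewrite -image_comp => qcEL.
have cE_L : c @` E #<= [set: L].
  apply: card_le_trans qcEL; rewrite (card_le_eqr (inj_card_eq _)) //.
  move=> _ _ /set_mem[x _ <-] /set_mem[y _ <-].
  by apply: qinj; apply: mem_set; exact: (cP _).1.
(* If the image of [E] under [c] is cofinal, it has at least [cfK] elements, more than [L]. If not,
   it stays below some [x], and so does [E], which then has fewer than [K] elements. *)
have [cEcof|/existsNP[x nx]] := pselect (cofinal r (c @` E)).
  apply: LnK; rewrite card_eq_le LK /= -(card_le_eql Ccf).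
  exact: card_le_trans (Cmin _ cEcof) cE_L.
have [segK] := seg x; apply; rewrite card_eq_le segK /= -(card_le_eql EK).
apply: subset_card_le => y Ey.
have nxy : ~ r x (c y) by move=> xy; apply: nx; exists (c y) => //; exists y.
split; last by move=> yx; apply: nxy; rewrite -yx; exact: (cP y).2.
have [//|cyx] := well_order_total rwo x (c y).
exact: (well_order_trans rwo (cP y).2 cyx).
Qed.
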